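(* Let $X$ be a linear $n$-normed space over $\mathbb{K}$, let $b_2,\dots,b_n\in X$ be fixed elements, and let $M$ be a fundamental (total) subset of $X_F^{*}$. A sequence $\{x_k\}$ in $X$ converges $b$-weakly to $x\in X$ if and only if (I) the sequence $\{\|x_k,b_2,\dots,b_n\|\}$ is bounded, and (II) $\lim_{k\to\infty}T(x_k,b_2,\dots,b_n)=T(x,b_2,\dots,b_n)$ for all $T\in M$.
   Context: Let $n$ be a positive integer and let $X$ be a linear space over $\mathbb{K}$ ($=\mathbb{R}$ or $\mathbb{C}$) with $\dim X\ge n$. An $n$-norm on $X$ is a function $\|\cdot,\dots,\cdot\|:X^n\to\mathbb{R}$ such that: (N1) $\|x_1,\dots,x_n\|=0$ if and only if $x_1,\dots,x_n$ are linearly dependent; (N2) $\|x_1,\dots,x_n\|$ is invariant under permutations of $x_1,\dots,x_n$; (N3) $\|\alpha x_1,x_2,\dots,x_n\|=|\alpha|\,\|x_1,x_2,\dots,x_n\|$ for all $\alpha\in\mathbb{K}$; (N4) $\|x+y,x_2,\dots,x_n\|\le\|x,x_2,\dots,x_n\|+\|y,x_2,\dots,x_n\|$. The pair $(X,\|\cdot,\dots,\cdot\|)$ is a linear $n$-normed space. Fix $b_2,\dots,b_n\in X$ and let $\langle b_i\rangle$ be the subspace generated by $b_i$. A $b$-linear functional on $X\times\langle b_2\rangle\times\cdots\times\langle b_n\rangle$ is a map $T:X\times\langle b_2\rangle\times\cdots\times\langle b_n\rangle\to\mathbb{K}$ with $T(x+y,b_2,\dots,b_n)=T(x,b_2,\dots,b_n)+T(y,b_2,\dots,b_n)$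 and $T(kx,b_2,\dots,b_n)=k\,T(x,b_2,\dots,b_n)$ for all $x,y\in X$, $k\in\mathbb{K}$. It is bounded if there is $C>0$ with $|T(x,b_2,\dots,b_n)|\le C\|x,b_2,\dots,b_n\|$ for all $x\in X$; its norm $\|T\|$ is the infimum of all such $C$. $X_F^{*}$ denotes the Banach space, under this norm, of all bounded $b$-linear functionals on $X\times\langle b_2\rangle\times\cdots\times\langle b_n\rangle$; functionals with the same values at all $(x,b_2,\dots,b_n)$, $x\in X$, are identified. A subset $M\subseteq X_F^{*}$ is fundamental (total) if its linear span is norm-dense in $X_F^{*}$. A sequence $\{x_k\}$ in $X$ converges $b$-weakly to $x\in X$ if $\lim_{k\to\infty}T(x_k,b_2,\dots,b_n)=T(x,b_2,\dots,b_n)$ for every $T\in X_F^{*}$. *)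

(* Defs.v *)
From HB Require Import structures.
From mathcomp Require Import all_boot all_order all_algebra all_fingroup.
From mathcomp Require Import complex.
From mathcomp Require Import all_classical all_reals all_analysis.

Set Implicit Arguments.
Unset Strict Implicit.
Unset Printing Implicit Defensive.

Import Order.TTheory GRing.Theory Num.Theory.
Import numFieldNormedType.Exports.

Local Open Scope classical_set_scope.
Local Open Scope ring_scope.

Inductive ground : Set := RealGround | ComplexGround.

Definition ground_field (R : realType) (g : ground) : numFieldType :=
  match g with RealGround => R | ComplexGround => R[i] end.

(* The norm of [R[i]] takes its values in [R[i]]; the inequalities between
   n-norms and moduli are stated in [R], hence [normc]. *)
Definition modulus (R : realType) (g : ground) : ground_field R g -> R :=
  match g with
  | RealGround => fun a : R => `|a|
  | ComplexGround => fun a : R[i] => ComplexField.Normc.normc a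
  end.

Definition lin_dependent (K : numFieldType) (X : lmodType K) (n : nat)
    (t : n.-tuple X) : Prop :=
  exists c : 'I_n -> K,
    (exists i, c i != 0) /\ \sum_(i < n) c i *: tnth t i = 0.

(* [dim X >= n], where [X] may be infinite-dimensional. *)
Definition dim_ge (K : numFieldType) (X : lmodType K) (n : nat) : Prop :=
  exists t : n.-tuple X, ~ lin_dependent t.

(* The positive arity is written [n.+1]: the first argument of the norm plays a
   distinguished role, the other [n] form a tuple. *)
Record is_nnorm (R : realType) (g : ground) (n : nat)
    (X : lmodType (ground_field R g)) (N : n.+1.-tuple X -> R) : Prop :=
  IsNNorm {
  nnorm_eq0 : forall t, N t = 0 <-> lin_dependent t;
  nnorm_perm : forall t (s : 'S_n.+1), N [tuple tnth t (s i) | i < n.+1] = N t;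
  nnormZ : forall a x (t : n.-tuple X),
    N [tuple of a *: x :: t] = modulus a * N [tuple of x :: t];
  nnormD : forall x y (t : n.-tuple X),
    N [tuple of x + y :: t] <= N [tuple of x :: t] + N [tuple of y :: t]
}.

Definition line (K : numFieldType) (X : lmodType K) (v : X) : set X :=
  [set k *: v | k in [set: K]].

Lemma line_id (K : numFieldType) (X : lmodType K) (v : X) : v \in line v.
Proof. by apply/mem_set; exists 1; rewrite ?scale1r. Qed.

(* [<b_2> x ... x <b_n>] *)
Definition lines (K : numFieldType) (X : lmodType K) (n : nat)
    (b : n.-tuple X) : Type :=
  forall i : 'I_n, set_type (line (tnth b i)).

Definition base (K : numFieldType) (X : lmodType K) (n : nat)
    (b : n.-tuple X) : lines b :=
  fun i => exist _ (tnth b i) (line_id (tnth b i)).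

Definition functional (K : numFieldType) (X : lmodType K) (n : nat)
    (b : n.-tuple X) : Type := X -> lines b -> K.

Definition b_linear (K : numFieldType) (X : lmodType K) (n : nat)
    (b : n.-tuple X) (T : functional b) : Prop :=
  (forall x y, T (x + y) (base b) = T x (base b) + T y (base b)) /\
  (forall k x, T (k *: x) (base b) = k * T x (base b)).

Definition bounds (R : realType) (g : ground) (n : nat)
    (X : lmodType (ground_field R g)) (N : n.+1.-tuple X -> R) (b : n.-tuple X)
    (T : functional b) : set R :=
  [set C | 0 < C /\
    forall x, modulus (T x (base b)) <= C * N [tuple of x :: b]].

Definition fnorm (R : realType) (g : ground) (n : nat)
    (X : lmodType (ground_field R g)) (N : n.+1.-tuple X -> R) (b : n.-tuple X)
    (T : functional b) : R := inf (bounds N T).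

(* [X_F^*].  Its elements are classes of functionals with the same values at all
   [(x, b_2, ..., b_n)]; we work with representatives.  [b_linear], [bounds] and
   [fnorm] depend only on those values, so [fnorm] is the norm of the class. *)
Definition dual (R : realType) (g : ground) (n : nat)
    (X : lmodType (ground_field R g)) (N : n.+1.-tuple X -> R)
    (b : n.-tuple X) : set (functional b) :=
  [set T | b_linear T /\ bounds N T !=set0].
Arguments dual {R g n X} N b _.

Definition lin_span (K : numFieldType) (X : lmodType K) (n : nat)
    (b : n.-tuple X) (M : set (functional b)) : set (functional b) :=
  [set S | exists (m : nat) (c : 'I_m -> K) (F : 'I_m -> functional b),
    (forall i, M (F i)) /\ S = fun x v => \sum_(i < m) c i * F i x v].

Definition fundamental (R : realType) (g : ground) (n : nat)
    (X : lmodType (ground_field R g)) (N : n.+1.-tuple X -> R) (b : n.-tuple X)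
    (M : set (functional b)) : Prop :=
  M `<=` dual N b /\
  forall T, dual N b T -> forall e : R, 0 < e ->
    exists2 S, lin_span M S & fnorm N (fun x v => T x v - S x v) < e.

Definition b_weakly_cvg (R : realType) (g : ground) (n : nat)
    (X : lmodType (ground_field R g)) (N : n.+1.-tuple X -> R) (b : n.-tuple X)
    (u : nat -> X) (x : X) : Prop :=
  forall T, dual N b T -> T (u k) (base b) @[k --> \oo] --> T x (base b).

(* Main.v *)
Require Import Defs.
From HB Require Import structures.
From mathcomp Require Import all_boot all_order all_algebra all_fingroup.
From mathcomp Require Import complex.
From mathcomp Require Import all_classical all_reals all_analysis.
From mathcomp Require Import ring lra.

Set Implicit Arguments.
Unset Strict Implicit.
Unset Printing Implicit Defensive.

Import Order.TTheory GRing.Theory Num.Theory.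
Import numFieldNormedType.Exports.

Local Open Scope classical_set_scope.
Local Open Scope ring_scope.

(** The map [p x = ||x, b_2, ..., b_n||] is a seminorm on [X], and a bounded
    b-linear functional is, through its values at [(x, b_2, ..., b_n)], a linear
    functional on [X] dominated by a multiple of [p].  So the statement is the
    classical characterization of weak convergence of sequences, for the
    seminormed space [(X, p)].

    That (I) and (II) imply weak convergence is an approximation argument: (II)
    passes to the linear span of [M] (lemma [lin_span_cvg]), and if [S] in the
    span is close to [T], then [T - S] is uniformly small on the vectors
    [u k - x], because [p (u k - x)] is bounded by (I).

    Conversely, a weakly convergent sequence has to be [p]-bounded.  This is the
    uniform boundedness principle on the dual, together with the Hahn-Banach
    theorem, which says that evaluation at a vector [v] has norm [p v] on the
    dual.  Completeness of the dual enters only as the convergence of one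
    explicit series, in a gliding hump argument (Sokal's proof of the uniform
    boundedness principle).  If [p] is unbounded along [u],
    choose vectors [v_n] of the sequence with [p v_n] growing faster than [3^n],
    and norming functionals [f_n] with [|f_n| <= p] and [f_n v_n = p v_n].  In
    the series [sum +- 3^-(n+1) f_n] each sign can be chosen so that the partial
    sum ending with the term in [f_n] is at least [3^-(n+1) p v_n] at [v_n].  The
    remaining terms contribute at most half of that, so the sum of the series is
    a functional dominated by [p] and unbounded along [u]; it takes no convergent
    sequence of values there ([unbounded_functional]).

    The Hahn-Banach theorem and the gliding hump are carried out over the reals.
    In the complex case they are applied to [X] with scalars restricted to the
    reals, and the functional [f] obtained is replaced by
    [x |-> f x - i f (i x)], which is complex-linear, dominated by [2 p], and at
    least as large as [f] in modulus ([unbounded_ground_functional]). *)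

(** * Real seminorms and the Hahn-Banach theorem *)

Definition seminorm {R : realType} {V : lmodType R} (p : V -> R) : Prop :=
  (forall x y, p (x + y) <= p x + p y) /\ (forall a x, p (a *: x) = `|a| * p x).

Lemma seminorm0 (R : realType) (V : lmodType R) (p : V -> R) :
  seminorm p -> p 0 = 0.
Proof. by move=> [_ pZ]; rewrite -(scale0r 0) pZ normr0 mul0r. Qed.

Lemma seminormN (R : realType) (V : lmodType R) (p : V -> R) x :
  seminorm p -> p (- x) = p x.
Proof. by move=> [_ pZ]; rewrite -scaleN1r pZ normrN1 mul1r. Qed.

Lemma seminorm_ge0 (R : realType) (V : lmodType R) (p : V -> R) x :
  seminorm p -> 0 <= p x.
Proof.
move=> hp; have := hp.1 x (- x).
by rewrite subrr (seminorm0 hp) (seminormN _ hp); lra.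
Qed.

Section HahnBanach.
Context (R : realType) (V : lmodType R) (p : V -> R).
Hypothesis hp : seminorm p.

(** Partial linear functionals are handled through their graphs, so that
    extending one is inclusion of sets.  Single-valuedness is no part of the
    definition, as it follows from linearity and domination. *)
Definition linear_graph (G : set (V * R)) : Prop :=
  forall a x r y s, G (x, r) -> G (y, s) -> G (a *: x + y, a * r + s).

Definition dominated_graph (G : set (V * R)) : Prop :=
  forall x r, G (x, r) -> r <= p x.

(** The difference of two values at [x] is a value at [0], hence at most
    [p 0 = 0]. *)
Lemma dominated_graph_fun (G : set (V * R)) x r s :
  linear_graph G -> dominated_graph G -> G (x, r) -> G (x, s) -> r = s.
Proof.
move=> Glin Gdom Gr Gs.
have h1 := Gdom _ _ (Glin (-1) _ _ _ _ Gr Gs).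
have h2 := Gdom _ _ (Glin (-1) _ _ _ _ Gs Gr).
by move: h1 h2; rewrite scaleN1r addNr (seminorm0 hp) !mulN1r; lra.
Qed.

Lemma linear_graph0 (G : set (V * R)) z :
  linear_graph G -> G z -> G (0, 0).
Proof.
case: z => x r Glin Gz; have := Glin (-1) _ _ _ _ Gz Gz.
by rewrite scaleN1r addNr mulN1r addNr.
Qed.

Definition graph_extension (G : set (V * R)) (x : V) (c : R) : set (V * R) :=
  [set z | exists a y r, G (y, r) /\ z = (y + a *: x, r + a * c)].

Lemma graph_extension_linear G x c :
  linear_graph G -> linear_graph (graph_extension G x c).
Proof.
move=> Glin k _ _ _ _ [a [y [r [Gy [-> ->]]]]] [a' [y' [r' [Gy' [-> ->]]]]].
exists (k * a + a'), (k *: y + y'), (k * r + r'); split; first exact: Glin.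
congr pair; last by ring.
by rewrite scalerDr scalerDl scalerA addrACA.
Qed.

(** The one-dimensional extension step.  Dividing by [|a|], domination at
    [y + a *: x] for all [a] amounts to [r - p (y - x) <= c <= p (y + x) - r] on
    [G].  Every lower bound is below every upper bound by the triangle
    inequality, so the supremum of the lower bounds is a possible [c]. *)
Lemma graph_extension_dominated G x : G !=set0 ->
  linear_graph G -> dominated_graph G ->
  exists c, dominated_graph (graph_extension G x c).
Proof.
move=> [z0 Gz0] Glin Gdom.
pose L := [set w | exists y r, G (y, r) /\ w = r - p (y - x)].
have Lub w y r : L w -> G (y, r) -> w <= p (y + x) - r.
  move=> [y' [r' [Gy' ->]]] Gy.
  have := Gdom _ _ (Glin 1 _ _ _ _ Gy' Gy); rewrite scale1r mul1r.
  have := hp.1 (y' - x) (y + x); rewrite addrACA addNr addr0; lra.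
have hL : has_sup L.
  have G0 := linear_graph0 Glin Gz0.
  split; first by exists (0 - p (0 - x)), 0, 0.
  by exists (p (0 + x) - 0) => w Lw; exact: Lub.
have cub y r : G (y, r) -> sup L <= p (y + x) - r.
  by move=> Gy; apply: (ge_sup hL.1) => w Lw; exact: Lub.
have clb y r : G (y, r) -> r - p (y - x) <= sup L.
  by move=> Gy; apply: (ub_le_sup hL.2); exists y, r.
have Gscale a y r : G (y, r) -> G (a *: y, a * r).
  move=> Gy; have := Glin a _ _ _ _ Gy (linear_graph0 Glin Gy).
  by rewrite !addr0.
exists (sup L) => _ _ [a [y [r [Gy [-> ->]]]]].
have [->|a0] := eqVneq a 0; first by rewrite scale0r mul0r !addr0; exact: Gdom.
have [a_lt0|a_gt0|/eqP] := ltgtP a 0; last by rewrite (negbTE a0).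
- have Na_gt0 : 0 < (- a)^-1 by rewrite invr_gt0 oppr_gt0.
  rewrite -(ler_pM2l Na_gt0); have := clb _ _ (Gscale (- a)^-1 _ _ Gy).
  have -> : (- a)^-1 *: y - x = (- a)^-1 *: (y + a *: x).
    by rewrite scalerDr scalerA invrN mulNr mulVf// scaleN1r.
  rewrite hp.2 (gtr0_norm Na_gt0).
  have -> : (- a)^-1 * (r + a * sup L) = (- a)^-1 * r - sup L by field.
  by lra.
- have ai_gt0 : 0 < a^-1 by rewrite invr_gt0.
  rewrite -(ler_pM2l ai_gt0); have := cub _ _ (Gscale a^-1 _ _ Gy).
  have -> : a^-1 *: y + x = a^-1 *: (y + a *: x).
    by rewrite scalerDr scalerA mulVf// scale1r.
  rewrite hp.2 (gtr0_norm ai_gt0).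
  have -> : a^-1 * (r + a * sup L) = a^-1 * r + sup L by field.
  by lra.
Qed.

Theorem hahn_banach (x0 : V) :
  exists f : V -> R, [/\ scalar f, forall x, `|f x| <= p x & f x0 = p x0].
Proof.
(* The last condition of [P] reads [G (x0, p x0)] for nonempty [G]; it is
   weakened to hold for the empty set, which is the union of the empty chain. *)
pose P (G : set (V * R)) :=
  [/\ linear_graph G, dominated_graph G & forall z, G z -> G (x0, p x0)].
have [|G [[Glin Gdom Gx0] Gmax]] := @Zorn_bigcup _ P.
- move=> F FP Ftot; split.
  + move=> a x r y s [A FA Ax] [B FB By].
    have [AB|BA] := Ftot _ _ FA FB.
    * by exists B => //; have [+ _ _] := FP _ FB; apply => //; exact: AB.
    * by exists A => //; have [+ _ _] := FP _ FA; apply => //; exact: BA.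
  + by move=> x r [A FA Ax]; have [_ + _] := FP _ FA; apply.
  + by move=> z [A FA Az]; exists A => //; have [_ _ +] := FP _ FA; apply; exact: Az.
(* Were [G] empty, the line through [(x0, p x0)] would be strictly larger. *)
have Gn0 : G !=set0.
  apply/set0P/eqP => G0.
  apply: (Gmax [set (a *: x0, a * p x0) | a in [set: R]]).
    rewrite G0; split=> [//|/(_ (1 *: x0, 1 * p x0))]; apply; exists 1 => //.
  split.
  + move=> a _ _ _ _ [b _ [<- <-]] [c _ [<- <-]]; exists (a * b + c) => //.
    by congr pair; [rewrite scalerDl scalerA | ring].
  + move=> _ _ [a _ [<- <-]]; rewrite hp.2 ler_wpM2r ?ler_norm//.
    exact: seminorm_ge0.
  + by move=> _ _; exists 1 => //; rewrite scale1r mul1r.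
have Gtot x : exists r, G (x, r).
  have [c cdom] := graph_extension_dominated x Gn0 Glin Gdom.
  have [z Gz] := Gn0.
  have sub : G `<=` graph_extension G x c.
    move=> [y r] Gy; exists 0, y, r; split => //.
    by rewrite scale0r mul0r !addr0.
  have Ex : graph_extension G x c (x, c).
    exists 1, 0, 0; split; first exact: linear_graph0 Gz.
    by rewrite scale1r mul1r !add0r.
  exists c; apply: contrapT => nGx.
  apply: (Gmax (graph_extension G x c)).
    by split=> // /(_ _ Ex).
  split=> //; first exact: graph_extension_linear.
  by move=> _ _; apply: sub; exact: Gx0 Gz.
have [f Gf] := choice Gtot.
have flin : scalar f.
  move=> a x y; apply: (dominated_graph_fun (x := a *: x + y) Glin Gdom) => //.
  exact: Glin.
exists f; split=> //.
- move=> x; rewrite ler_norml (Gdom _ _ (Gf x)) andbT.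
  have := Gdom _ _ (Gf (- x)); rewrite (seminormN _ hp).
  have := flin (-1) x 0; rewrite scaleN1r addr0 mulN1r => ->.
  have := flin (-1) 0 0; rewrite scaleN1r addr0 oppr0 mulN1r.
  by lra.
- have [z Gz] := Gn0.
  by apply: (dominated_graph_fun (x := x0) Glin Gdom) => //; exact: Gx0 Gz.
Qed.

End HahnBanach.

(** * The gliding hump *)

Section GlidingHump.
Context (R : realType) (V : lmodType R) (p : V -> R).
Context (f : nat -> V -> R).
Hypothesis flin : forall n, scalar (f n).
Hypothesis fp : forall n x, `|f n x| <= p x.

(** The partial sums of [sum +- 3^-(n+1) f_n].  The sign of the last term is the
    one that makes the sum large at [v n]; one of the two does, since the two
    candidates differ by twice that term. *)
Fixpoint hump_sum (v : nat -> V) n : V -> R :=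
  if n isn't n'.+1 then fun=> 0 else
  let S := hump_sum v n' in let h := 3^-1 ^+ n in
  let e := if h * `|f n' (v n')| <= `|S (v n') + h * f n' (v n')| then h else - h in
  fun x => S x + e * f n' x.

Lemma hump_sum_scalar v n : scalar (hump_sum v n).
Proof.
elim: n => [|n IH] a x y /=; first by rewrite mulr0 addr0.
by rewrite IH flin; ring.
Qed.

Lemma hump_sum_step v n x :
  `|hump_sum v n.+1 x - hump_sum v n x| <= 3^-1 ^+ n.+1 * p x.
Proof.
rewrite /= addrC addKr normrM.
have h0 : 0 <= 3^-1 ^+ n.+1 :> R by rewrite exprn_ge0// invr_ge0.
by case: ifP => _; rewrite ?normrN (ger0_norm h0) ler_wpM2l.
Qed.

Lemma hump_sum_large v n :
  3^-1 ^+ n.+1 * `|f n (v n)| <= `|hump_sum v n.+1 (v n)|.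
Proof.
rewrite /=; case: ifPn => // hlt; move: hlt; rewrite -ltNge.
set h := 3^-1 ^+ _; set S := hump_sum _ _ _; set t := f _ _ => hlt.
have h0 : 0 <= h by rewrite exprn_ge0// invr_ge0.
have := ler_normB (S + h * t) (S - h * t).
have -> : S + h * t - (S - h * t) = 2 * (h * t) by ring.
by rewrite mulNr !normrM (ger0_norm h0) ger0_norm//; lra.
Qed.

(** The tail [sum_(k > n) 3^-k] is [3^-n / 2].  Corrected by this multiple of
    [p x] on either side, the partial sums at [x] become adjacent sequences, which
    gives convergence and the error bound together. *)
Lemma hump_sum_limit v : exists g : V -> R, scalar g /\
  forall n x, `|g x - hump_sum v n x| <= 3^-1 ^+ n / 2 * p x.
Proof.
pose q n : R := 3^-1 ^+ n / 2.
have qS n : q n = q n.+1 + 3^-1 ^+ n.+1 by rewrite /q exprS; lra.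
have q0 : q @ \oo --> (0 : R).
  rewrite -(mul0r 2^-1); apply: cvgMl.
  have := @cvg_geometric R 1 3^-1; rewrite /geometric /=.
  under eq_fun do rewrite mul1r.
  by apply; rewrite ger0_norm; lra.
pose S n x := hump_sum v n x.
have Sstep n x : S n x - q n * p x <= S n.+1 x - q n.+1 * p x /\
    S n.+1 x + q n.+1 * p x <= S n x + q n * p x.
  have := hump_sum_step v n x; rewrite ler_norml -!/(S _ x) (qS n) => /andP[].
  by set h := _ ^+ _; split; lra.
have qp0 x : (fun n => q n * p x) @ \oo --> (0 : R).
  by rewrite -(mul0r (p x)); exact: cvgMl.
have incr x : nondecreasing_seq (fun n => S n x - q n * p x).
  by apply/nondecreasing_seqP => n; have [] := Sstep n x.
have decr x : nonincreasing_seq (fun n => S n x + q n * p x).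
  by apply/nonincreasing_seqP => n; have [] := Sstep n x.
pose g x := limn (fun n => S n x - q n * p x).
have adj x : [/\ limn (fun n => S n x + q n * p x) = g x,
    cvgn (fun n => S n x - q n * p x) & cvgn (fun n => S n x + q n * p x)].
  apply: adjacent_seq => //.
  rewrite (_ : _ - _ = fun n => 2 * (q n * p x)); last first.
    by apply/funext => n; rewrite !fctE; ring.
  by rewrite -(mulr0 2); apply: cvgMr; exact: qp0.
have Sg x : (S n x) @[n --> \oo] --> g x.
  have [_ c _] := adj x.
  rewrite (_ : (fun n => S n x) = fun n => (S n x - q n * p x) + q n * p x); last first.
    by apply/funext => n; rewrite subrK.
  by rewrite -[g x]addr0; apply: cvgD => //; exact: qp0.
exists g; split.
- move=> a x y; apply/esym; apply: (cvg_unique _ _ (Sg (a *: x + y))) => //.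
  rewrite (_ : (fun n => S n (a *: x + y)) = fun n => a * S n x + S n y); last first.
    by apply/funext => n; exact: hump_sum_scalar.
  apply: cvgD; last exact: Sg.
  by apply: cvgMr; exact: Sg.
- move=> n x; have [e c d] := adj x.
  have := nondecreasing_cvgn_le (incr x) c n.
  have := nonincreasing_cvgn_ge (decr x) d n.
  by rewrite e -/(g x) -/(S n x) -/(q n) ler_norml; lra.
Qed.

End GlidingHump.

(** The contrapositive of the uniform boundedness principle for the evaluations
    at the vectors [u k], with a witness. *)
Lemma unbounded_functional (R : realType) (V : lmodType R) (p : V -> R)
    (u : nat -> V) :
  seminorm p -> (forall B, exists k, B < p (u k)) ->
  exists g : V -> R, [/\ scalar g, forall x, `|g x| <= p x &
    forall B, exists k, B < `|g (u k)|].
Proof.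
move=> hp pu.
(* At [v_n] the limit is at least [3^-(n+1) / 2 * p v_n], which the growth
   required here makes larger than [n]. *)
have [k pk] := choice (fun n : nat => pu (n%:R * (2 * 3 ^+ n.+1))).
have [f hf] := choice (fun n => hahn_banach hp (u (k n))).
have flin n : scalar (f n) by have [] := hf n.
have fp n x : `|f n x| <= p x by have [] := hf n.
have [g [glin gS]] := hump_sum_limit flin fp (u \o k).
exists g; split => // [x|B].
  have := gS 0 x; have := seminorm_ge0 x hp.
  by rewrite expr0 subr0; lra.
pose n := (Num.truncn B).+1; exists (k n); set w := u _.
have Bn : B < n%:R by exact: truncnS_gt.
have h0 : 0 < 3^-1 ^+ n.+1 :> R by rewrite exprn_gt0// invr_gt0.
have h1 : 3^-1 ^+ n.+1 * 3 ^+ n.+1 = 1 :> R.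
  by rewrite -exprMn mulVf// expr1n.
have := gS n.+1 w; have := hump_sum_large f (u \o k) n.
have := pk n; rewrite -(ltr_pM2l h0) (_ : (u \o k) n = w)//.
have [_ _ ->] := hf n; rewrite ger0_norm ?seminorm_ge0//.
set S := hump_sum _ _ _ _; set h := _ ^+ n.+1 in h0 h1 *.
rewrite -/w.
have -> : h * (n%:R * (2 * 3 ^+ n.+1)) = (h * 3 ^+ n.+1) * (2 * n%:R) by ring.
rewrite h1 mul1r.
have := lerB_dist S (g w); rewrite distrC.
by lra.
Qed.

(** * The modulus of the ground field *)

Section Modulus.
Context (R : realType) (g : ground).
Local Notation K := (ground_field R g).
Implicit Types a b : K.

Lemma modulusM a b : modulus (a * b) = modulus a * modulus b.
Proof. by case: g a b => a b; [exact: normrM | exact: Normc.normcM]. Qed.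

Lemma modulusD a b : modulus (a + b) <= modulus a + modulus b.
Proof. by case: g a b => a b; [exact: ler_normD | exact: le_normcD]. Qed.

Lemma modulusN a : modulus (- a) = modulus a.
Proof. by case: g a => a; [exact: normrN | exact: normcN]. Qed.

Lemma modulus0 : modulus (0 : K) = 0.
Proof. by case: g; [exact: normr0 | exact: Normc.normc0]. Qed.

Lemma modulus1 : modulus (1 : K) = 1.
Proof. by case: g; [exact: normr1 | exact: Normc.normc1]. Qed.

Lemma modulus_ge0 a : 0 <= modulus a.
Proof.
by have := modulusD a (- a); rewrite subrr modulus0 modulusN; lra.
Qed.

Lemma modulus_sum (I : finType) (F : I -> K) :
  modulus (\sum_i F i) <= \sum_i modulus (F i).
Proof.
elim/big_ind2 : _ => [|x a y b ax by'|//]; first by rewrite modulus0.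
by apply: le_trans (modulusD _ _) _; exact: lerD.
Qed.

End Modulus.

(** The norm that defines the topology of [R[i]] has values in [R[i]]; this
    brings convergence in either field back to a real sequence. *)
Lemma modulus_cvgP (R : realType) (g : ground) (f : nat -> ground_field R g)
    (l : ground_field R g) :
  f k @[k --> \oo] --> l <-> modulus (f k - l) @[k --> \oo] --> (0 : R).
Proof.
rewrite cvgr0Pnorm_lt cvgrPdistC_lt.
case: g f l => f l /=.
  split=> fl e e0; have := fl e e0; apply: filterS => k; by rewrite normr_id.
split=> [fl e e0|fl e].
  have := fl e%:C%C; rewrite ltcR => /(_ e0); apply: filterS => k.
  rewrite -[`|f k - l|]/((ComplexField.Normc.normc (f k - l))%:C)%C ltcR.
  by rewrite ger0_norm//; exact: (@modulus_ge0 R ComplexGround).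
(* A positive element of [R[i]] is real. *)
case: e => e e'; rewrite ltcE /= => /andP[/eqP -> e0].
have := fl e e0; apply: filterS => k.
rewrite ger0_norm; last exact: (@modulus_ge0 R ComplexGround).
rewrite -[`|f k - l|]/((ComplexField.Normc.normc (f k - l))%:C)%C.
by rewrite -[(e +i* 0)%C]/(e%:C)%C ltcR.
Qed.

(** * From real to complex functionals *)

(** A copy of [X], to carry the restriction of scalars to [R]. *)
Definition realification (R : realType) (X : lmodType R[i]) : Type := X.

Section Realification.
Context (R : realType) (X : lmodType R[i]).

HB.instance Definition _ := GRing.Zmodule.on (realification X).

Definition real_scale (a : R) (x : realification X) : realification X :=
  (a%:C)%C *: (x : X).

Fact real_scaleA a b x : real_scale a (real_scale b x) = real_scale (a * b) x.
Proof. by rewrite /real_scale scalerA rmorphM. Qed.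

Fact real_scale1 : left_id 1 real_scale.
Proof. by move=> x; exact: scale1r. Qed.

Fact real_scaleDr : right_distributive real_scale +%R.
Proof. by move=> a x y; exact: scalerDr. Qed.

Fact real_scaleDl x : {morph real_scale^~ x : a b / a + b}.
Proof. by move=> a b; rewrite /real_scale rmorphD; exact: scalerDl. Qed.

HB.instance Definition _ := GRing.Zmodule_isLmodule.Build R (realification X)
  real_scaleA real_scale1 real_scaleDr real_scaleDl.

End Realification.

(** The complex-linear functional with real part [f]. *)
Definition complexify (R : realType) (X : lmodType R[i])
    (f : realification X -> R) (x : X) : R[i] :=
  (f x +i* - f ('i *: x))%C.

Section Complexify.
Context (R : realType) (X : lmodType R[i]) (f : realification X -> R).
Hypothesis flin : scalar f.

Let fD x y : f (x + y) = f x + f y.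
Proof. by have := flin 1 x y; rewrite scale1r mul1r. Qed.

Let f0 : f 0 = 0.
Proof. by have := fD 0 0; rewrite addr0; lra. Qed.

Let fZ a x : f (a *: x) = a * f x.
Proof. by have := flin a x 0; rewrite !addr0 f0 addr0. Qed.

Lemma complexifyD x y : complexify f (x + y) = complexify f x + complexify f y.
Proof. by rewrite /complexify scalerDr !fD opprD. Qed.

(** By real linearity [f (c *: y) = Re c * f y + Im c * f ('i *: y)]; comparing
    real and imaginary parts of both sides then is a computation. *)
Lemma complexifyZ k x : complexify f (k *: x) = k * complexify f x.
Proof.
have fZC (c : R[i]) (y : X) : f (c *: y) = complex.Re c * f y + complex.Im c * f ('i%C *: y).
  rewrite {1}[c]complexE scalerDl fD -!fZ; congr (_ + f _).
  by rewrite mulrC -scalerA.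
rewrite /complexify scalerA (mulrC 'i%C) (fZC k) (fZC (k * 'i%C)) ReiNIm ImiRe.
case: k => a b /=; apply/eqP; rewrite eq_complex /=.
by apply/andP; split; apply/eqP; ring.
Qed.

Lemma Re_le_complexify x : `|f x| <= ComplexField.Normc.normc (complexify f x).
Proof. by have := normc_ge_Re (complexify f x); rewrite lecR. Qed.

Lemma complexify_le x :
  ComplexField.Normc.normc (complexify f x) <= `|f x| + `|f ('i%C *: (x : X))|.
Proof.
have -> : complexify f x = (f x +i* 0)%C + (0 +i* - f ('i%C *: (x : X)))%C.
  by rewrite /complexify -[RHS]/(_ +i* _)%C addr0 add0r.
apply: le_trans (le_normcD _ _) _ => /=.
by rewrite expr0n /= addr0 add0r !sqrtr_sqr normrN.
Qed.

End Complexify.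

(** For [RealGround] this is [seminorm]; the real-valued [modulus] replaces the
    norm of the field to cover both cases. *)
Definition ground_seminorm (R : realType) (g : ground)
    (X : lmodType (ground_field R g)) (p : X -> R) : Prop :=
  (forall x y, p (x + y) <= p x + p y) /\
  (forall a x, p (a *: x) = modulus a * p x).

(** The factor [2] comes from bounding the two parts of [complexify f]
    separately: both [|f x|] and [|f (i x)|] are at most [p x]. *)
Lemma unbounded_ground_functional (R : realType) (g : ground)
    (X : lmodType (ground_field R g)) (p : X -> R) (u : nat -> X) :
  ground_seminorm p -> (forall B, exists k, B < p (u k)) ->
  exists f : X -> ground_field R g,
    [/\ forall x y, f (x + y) = f x + f y, forall k x, f (k *: x) = k * f x,
        forall x, modulus (f x) <= 2 * p x &
        forall B, exists k, B < modulus (f (u k))].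
Proof.
case: g X p u => X p u hp pu.
  have [f [flin fp fu]] := @unbounded_functional R X p u hp pu.
  exists f; split=> //.
  + by move=> x y; have := flin 1 x y; rewrite scale1r mul1r.
  + move=> k x; have := flin k x 0; rewrite !addr0 => ->.
    by have := flin 1 0 0; rewrite scale1r addr0 mul1r; lra.
  + by move=> x; apply: le_trans (fp x) _; have := seminorm_ge0 x hp; lra.
have modC (a : R) : ComplexField.Normc.normc (a%:C)%C = `|a|.
  by rewrite /= expr0n /= addr0 sqrtr_sqr.
have hpR : @seminorm R (realification X) p.
  by split=> [|a x]; [exact: hp.1 | rewrite -modC; exact: hp.2].
have [f [flin fp fu]] := @unbounded_functional R (realification X) p u hpR pu.
exists (complexify f); split.
- exact: complexifyD.
- exact: complexifyZ.
- move=> x; rewrite -[modulus _]/(ComplexField.Normc.normc (complexify f x)).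
  have := complexify_le f x.
  have := fp ('i%C *: x : X).
  have -> : p ('i%C *: x) = p x.
    by rewrite hp.2 /= expr0n /= expr1n add0r sqrtr1 mul1r.
  by have := fp x; lra.
- move=> B; have [k Bk] := fu B; exists k.
  exact: lt_le_trans Bk (Re_le_complexify f (u k)).
Qed.

(** * The dual of an n-normed space with respect to [b] *)

Lemma bounded_seqP (R : realType) (a : nat -> R) :
  bounded_fun a <-> exists B, forall k, `|a k| <= B.
Proof.
have PF : ProperFilter (globally [set: nat]) by exact: (@globally_properfilter _ _ 0%N).
split=> [/ex_bound[B aB]|[B aB]]; first by exists B => k; exact: aB.
by apply/ex_bound; exists B => k _; exact: aB.
Qed.

Section SliceSeminorm.
Context (R : realType) (g : ground) (n : nat) (X : lmodType (ground_field R g)).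
Context (N : n.+1.-tuple X -> R) (hN : is_nnorm N) (b : n.-tuple X).

Lemma slice_seminorm : ground_seminorm (fun x => N [tuple of x :: b]).
Proof. by split=> [x y|a x]; [exact: nnormD | exact: nnormZ]. Qed.

End SliceSeminorm.

Lemma ground_seminormB (R : realType) (g : ground)
    (X : lmodType (ground_field R g)) (p : X -> R) x y :
  ground_seminorm p -> 0 <= p (x - y) <= p x + p y.
Proof.
move=> hp.
have p0 : p 0 = 0 by rewrite -(scale0r 0) hp.2 modulus0 mul0r.
have pN z : p (- z) = p z.
  by rewrite -scaleN1r hp.2 modulusN modulus1 mul1r.
have := hp.1 x (- y); have := hp.1 (x - y) (- (x - y)).
by rewrite subrr p0 !pN => h1 ->; rewrite andbT; lra.
Qed.

Section Dual.
Context (R : realType) (g : ground) (n : nat) (X : lmodType (ground_field R g)).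
Context (N : n.+1.-tuple X -> R) (hN : is_nnorm N) (b : n.-tuple X).
Local Notation K := (ground_field R g).

Lemma b_linearB (T : functional b) x y :
  b_linear T -> T (x - y) (base b) = T x (base b) - T y (base b).
Proof. by move=> [TD TZ]; rewrite TD -scaleN1r TZ mulN1r. Qed.

Lemma slice_ge0 x : 0 <= N [tuple of x :: b].
Proof.
have := ground_seminormB x 0 (slice_seminorm hN b).
by rewrite subr0 => /andP[].
Qed.

Lemma dual_lin_span (M : set (functional b)) :
  M `<=` dual N b -> lin_span M `<=` dual N b.
Proof.
move=> Mdual _ [m [c [F [MF ->]]]]; split.
  split=> [x y|k x]; first rewrite -big_split; last rewrite mulr_sumr.
    by apply: eq_bigr => i _; have [[-> _] _] := Mdual _ (MF i); rewrite mulrDr.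
  by apply: eq_bigr => i _; have [[_ ->] _] := Mdual _ (MF i); rewrite mulrCA.
have [C FC] := choice (fun i => (Mdual _ (MF i)).2).
(* The summand [1] makes the bound positive, also for an empty sum. *)
exists (1 + \sum_i modulus (c i) * C i); split.
  rewrite ltr_pwDl// sumr_ge0// => i _.
  by rewrite mulr_ge0 ?modulus_ge0// ltW//; have [] := FC i.
move=> x; apply: le_trans (modulus_sum _) _.
rewrite mulrDl mul1r mulr_suml -[leLHS]add0r lerD ?slice_ge0// ler_sum// => i _.
have [_ Fi] := FC i.
by rewrite modulusM -mulrA ler_wpM2l ?modulus_ge0.
Qed.

(** [fnorm] is an infimum of reals, and [inf] of the empty set is [0]: that
    [T - S] has some bound is what turns [fnorm < e] into a bound below [e]. *)
Lemma dual_bounds_small (T S : functional b) e :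
  dual N b T -> dual N b S -> fnorm N (fun x v => T x v - S x v) < e ->
  exists2 C, C < e & bounds N (fun x v => T x v - S x v) C.
Proof.
move=> [_ [C [C0 TC]]] [_ [D [D0 SD]]] Ne.
have bn0 : bounds N (fun x v => T x v - S x v) !=set0.
  exists (C + D); split; first exact: addr_gt0.
  move=> x; apply: le_trans (modulusD _ _) _.
  by rewrite modulusN mulrDl lerD.
have [c cb ce] := inf_lt bn0 Ne.
by exists c.
Qed.

Lemma lin_span_cvg (M : set (functional b)) (S : functional b) u x :
  (forall T, M T -> T (u k) (base b) @[k --> \oo] --> T x (base b)) ->
  lin_span M S -> S (u k) (base b) @[k --> \oo] --> S x (base b).
Proof.
move=> Mu [m [c [F [MF ->]]]].
apply: cvg_big => [|i _]; first exact: add_continuous.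
by apply: cvgMr; exact: Mu.
Qed.

(** Otherwise [unbounded_ground_functional] yields an element of the dual with
    unbounded, hence divergent, values along [u]. *)
Lemma b_weakly_cvg_bounded u x :
  b_weakly_cvg N b u x -> bounded_fun (fun k => N [tuple of u k :: b]).
Proof.
move=> ux; apply: contrapT => nb.
have pu B : exists k, B < N [tuple of u k :: b].
  apply: contrapT => /forallNP nB; apply: nb; apply/bounded_seqP.
  exists B => k; rewrite ger0_norm ?slice_ge0// leNgt.
  exact/negP/nB.
have [f [fD fZ fp fu]] := unbounded_ground_functional (slice_seminorm hN b) pu.
pose T : functional b := fun x _ => f x.
have /ux/modulus_cvgP/cvgP/cvg_seq_bounded/bounded_seqP[B TB] : dual N b T.
  by split; [split | exists 2; split].
have [k] := fu (B + modulus (f x)).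
have := TB k; rewrite ger0_norm ?modulus_ge0//.
have := modulusD (f (u k) - f x) (f x); rewrite subrK /T; lra.
Qed.

(** With [S] in the span of [M] near [T],
    [T (u k) - T x = (T - S) (u k - x) + (S (u k) - S x)]: the first term is small
    for all [k] by boundedness, the second for large [k]. *)
Lemma bounded_total_cvg (M : set (functional b)) u x :
  fundamental N M ->
  bounded_fun (fun k => N [tuple of u k :: b]) ->
  (forall T, M T -> T (u k) (base b) @[k --> \oo] --> T x (base b)) ->
  b_weakly_cvg N b u x.
Proof.
move=> [Mdual Mtotal] /bounded_seqP[B uB] Mu T dT.
apply/modulus_cvgP/cvgr0Pnorm_lt => e e0.
have {}uB k : N [tuple of u k :: b] <= B.
  by have := uB k; rewrite ger0_norm ?slice_ge0.
(* [A] bounds all [N (u k - x, b)]; the summand [1] makes it positive. *)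
pose A := B + N [tuple of x :: b] + 1.
have A0 : 0 < A.
  by have := uB 0%N; have := slice_ge0 (u 0%N); have := slice_ge0 x; rewrite /A; lra.
have d0 : 0 < e / 2 / A by rewrite !divr_gt0.
have [S MS TS] := Mtotal T dT _ d0.
have dS := dual_lin_span Mdual MS.
have [C Ce [C0 TSC]] := dual_bounds_small dT dS TS.
have /modulus_cvgP/cvgr0Pnorm_lt/(_ (e / 2)) := lin_span_cvg Mu MS.
rewrite divr_gt0// => /(_ erefl); apply: filterS => k.
rewrite !ger0_norm ?modulus_ge0// => Sk.
have := TSC (u k - x); rewrite !(b_linearB _ _ dT.1) !(b_linearB _ _ dS.1).
have /andP[p0 pB] := ground_seminormB (u k) x (slice_seminorm hN b).
have CA : C * N [tuple of u k - x :: b] <= e / 2.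
  apply: le_trans (_ : C * A <= _).
    rewrite ler_wpM2l ?ltW//; apply: le_lt_trans pB _.
    by have := uB k; rewrite /A; lra.
  by rewrite -ler_pdivlMr// ltW.
have := modulusD (T (u k) (base b) - T x (base b) - (S (u k) (base b) - S x (base b)))
  (S (u k) (base b) - S x (base b)).
rewrite subrK.
by lra.
Qed.

End Dual.
(** * The characterization of b-weak convergence *)

Theorem theorem5p4 (R : realType) (g : ground) (n : nat)
    (X : lmodType (ground_field R g)) (hdim : dim_ge X n.+1)
    (N : n.+1.-tuple X -> R) (hN : is_nnorm N)
    (b : n.-tuple X) (M : set (functional b)) (hM : fundamental N M)
    (u : nat -> X) (x : X) :
  b_weakly_cvg N b u x <->
    bounded_fun (fun k => N [tuple of u k :: b]) /\
    (forall T, M T -> T (u k) (base b) @[k --> \oo] --> T x (base b)).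
Proof.
split=> [ux|[uB Mu]]; last exact: bounded_total_cvg hM uB Mu.
split; first exact: b_weakly_cvg_bounded ux.
by move=> T MT; apply: ux; exact: hM.1.
Qed.
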